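(* Let $\mathbf D=\mathbf D(k,\pi_\bullet)$ be a generalized divided power algebra over a noetherian commutative ring $k$. Assume the Jacobson radical of $k$ contains $\pi_n$ for infinitely many $n$. Let $M$ and $N$ be finitely presented graded $\mathbf D$-modules such that $\tau_{\ge n}(M)\cong\tau_{\ge n}(N)$ as graded $\mathbf D$-modules for some $n$. Then $M\cong N$ as graded $\mathbf D$-modules. Consequently, any two weak fp-envelopes of a nearly finitely presented graded $\mathbf D$-module are isomorphic.
   Context: $\pi$-sequences. A $\pi$-sequence in $k$ is a sequence $(\pi_n)_{n\ge2}$ in $k$, with $\pi_1=0$. For integers $j\ge1$ and $n,m\ge0$ put $\epsilon_j(n,m)=\lfloor (n+m)/j\rfloor-\lfloor n/j\rfloor-\lfloor m/j\rfloor$, and $C(n,m)=\prod_{j\ge2}\pi_j^{\epsilon_j(n-m,m)}$. The sequence is admissible if, whenever $(\pi_n,\pi_m)\ne k$, $n\mid m$ or $m\mid n$. GDPAs. $\mathbf D(k,\pi_\bullet)$ is the graded $k$-algebra free on basis $x^{[i]}$ ($\deg x^{[i]}=i$) with $x^{[n-m]}x^{[m]}=C(n,m)x^{[n]}$. A GDPA is such an algebra with $\pi_\bullet$ admissible. Truncation and nfp modules. - $\tau_{\ge n}(M)=\bigoplus_{j\ge n}M_j$. - A graded $\mathbf D$-module $M$ is nearly finitely presented if each $M_j$ is finitely generated over $k$, $M_j=0$ for $j\ll 0$, and there is a finitely presented graded $N$ with $\tau_{\ge n}(M)\cong\tau_{\ge n}(N)$ for some $n$. - Any such $N$ is a weak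 fp-envelope of $M$. *)

(* Defs.v *)
From HB Require Import structures.
From mathcomp Require Import all_boot all_order all_algebra.
Set Implicit Arguments. Unset Strict Implicit. Unset Printing Implicit Defensive.
Import Order.TTheory GRing.Theory Num.Theory.
Local Open Scope ring_scope.

Section GDPA.
Variable k : comNzRingType.

Definition ideal (I : k -> Prop) : Prop :=
  [/\ I 0, (forall x y, I x -> I y -> I (x + y)) & (forall a x, I x -> I (a * x))].

Definition noetherian : Prop :=
  forall I, ideal I -> exists s : seq k,
    forall x, I x <-> exists c : 'I_(size s) -> k, x = \sum_(i < size s) c i * s`_i.

Definition maximal_ideal (I : k -> Prop) : Prop :=
  [/\ ideal I, ~ I 1 &
    forall J, ideal J -> (forall x, I x -> J x) -> (forall x, J x) \/ (forall x, J x -> I x)].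

Definition in_jacobson (x : k) : Prop := forall I, maximal_ideal I -> I x.

Definition eps (j a b : nat) : nat := ((a + b) %/ j - a %/ j - b %/ j)%N.

(* C(n,m) = prod_{j>=2} pi_j^{eps_j(n-m,m)}; factors with j > n are 1. *)
Definition Ccoef (pi : nat -> k) (n m : nat) : k :=
  \prod_(2 <= j < n.+1) pi j ^+ eps j (n - m) m.

Definition pi_sequence (pi : nat -> k) : Prop := pi 1%N = 0.

Definition admissible (pi : nat -> k) : Prop :=
  forall n m : nat, (0 < n)%N -> (0 < m)%N ->
    ~ (exists a b : k, a * pi n + b * pi m = 1) -> ((n %| m) || (m %| n))%N.

(* ---------- graded D(k,pi)-modules ----------
   A graded module is a family of k-modules M_j (j : int) together with the
   actions of the basis elements: gact j j' = multiplication by x^{[j'-j]} :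
   M_j -> M_j' (only meaningful for j <= j').  The module axioms for the
   algebra with basis x^{[i]}, x^{[n-m]} x^{[m]} = C(n,m) x^{[n]}, unit x^{[0]}: *)
Record gmod (pi : nat -> k) := GMod {
  comp :> int -> lmodType k;
  gact : forall j j' : int, {linear comp j -> comp j'};
  gact_id : forall j (v : comp j), gact j j v = v;
  gact_comp : forall (j j' j'' : int) (v : comp j), j <= j' -> j' <= j'' ->
    gact j' j'' (gact j j' v) =
      Ccoef pi `|j'' - j|%N `|j' - j|%N *: gact j j'' v
}.

Variable pi : nat -> k.

Definition giso (M N : gmod pi) : Prop :=
  exists f : forall j, {linear M j -> N j},
    (forall j, bijective (f j)) /\
    (forall j j' (v : M j), j <= j' -> f j' (gact M j j' v) = gact N j j' (f j v)).

(* tau_{>= n}(M) ~= tau_{>= n}(N) as graded modules, unfolded: components in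
   degrees < n are zero, so only degrees >= n matter. *)
Definition trunc_iso (n : int) (M N : gmod pi) : Prop :=
  exists f : forall j, {linear M j -> N j},
    (forall j, n <= j -> bijective (f j)) /\
    (forall j j' (v : M j), n <= j -> j <= j' ->
       f j' (gact M j j' v) = gact N j j' (f j v)).

(* ---------- finite presentation ----------
   Free graded module F = (+)_{t<r} D(-d t); an element of degree j is a
   coefficient vector c : 'I_r -> k, c t being the coefficient of
   x^{[j - d t]} e_t (so c t = 0 if j < d t). *)
Definition in_free r (d : 'I_r -> int) (j : int) (c : 'I_r -> k) : Prop :=
  forall t, j < d t -> c t = 0.

(* x^{[j-e]} acting on a degree-e element c of F, giving a degree-j element *)
Definition free_act r (d : 'I_r -> int) (e j : int) (c : 'I_r -> k) : 'I_r -> k :=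
  fun t => if d t <= e then Ccoef pi `|j - d t|%N `|e - d t|%N * c t else 0.

Definition eval_gens (M : gmod pi) r (d : 'I_r -> int) (g : forall t, M (d t))
  (j : int) (c : 'I_r -> k) : M j :=
  \sum_(t < r | d t <= j) c t *: gact M (d t) j (g t).

(* M is the cokernel of a map of finite free graded modules F1 -> F0:
   finitely many homogeneous generators g, and the graded relation module
   (kernel of F0 -> M) is generated by finitely many homogeneous relations rho. *)
Definition fin_pres (M : gmod pi) : Prop :=
  exists (r : nat) (d : 'I_r -> int) (g : forall t, M (d t)),
    (forall j (v : M j), exists c : 'I_r -> k, in_free d j c /\ v = eval_gens g j c) /\
    exists (s : nat) (e : 'I_s -> int) (rho : 'I_s -> 'I_r -> k),
      (forall l, in_free d (e l) (rho l) /\ eval_gens g (e l) (rho l) = 0) /\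
      (forall j (c : 'I_r -> k), in_free d j c -> eval_gens g j c = 0 ->
         exists b : 'I_s -> k, forall t,
           c t = \sum_(l < s | e l <= j) b l * free_act d (e l) j (rho l) t).

Definition fg_lmod (V : lmodType k) : Prop :=
  exists s : seq V, forall v : V,
    exists c : 'I_(size s) -> k, v = \sum_(i < size s) c i *: s`_i.

Definition nearly_fp (M : gmod pi) : Prop :=
  [/\ forall j, fg_lmod (M j),
      exists n0 : int, forall j (v : M j), j < n0 -> v = 0 &
      exists N : gmod pi, fin_pres N /\ exists n, trunc_iso n M N].

Definition weak_fp_envelope (N M : gmod pi) : Prop :=
  fin_pres N /\ exists n, trunc_iso n M N.

End GDPA.

(* Main.v *)
(* Indices [p] with [pi p] in the Jacobson radical are pairwise comparable under
   divisibility, and [C(n, m)] is a unit when [p] divides [n - m] and [m < p].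
   Hence, for such a [q] larger than all degrees involved, multiplication by
   [x^{[q]}] embeds the degree [j] part of the free cover of [M] as a direct
   summand of its degree [j + q] part, and the projection back to degree [j] is
   well defined and linear over the algebra modulo [a_q], the product of the
   [pi p], [p <= q], lying in the radical. An isomorphism in high degrees
   therefore sends the generators of [M] to elements of [N] satisfying the
   relations of [M] modulo [a_q]. For [q] large a noetherian argument corrects
   them, modulo [pi q], to elements satisfying the relations exactly. By
   Nakayama's lemma the resulting map [M -> N] is surjective; by symmetry there
   is a surjection [N -> M], and surjective endomorphisms of noetherian modules
   are injective. *)

Require Import Defs.
From HB Require Import structures.
From mathcomp Require Import all_boot all_order all_algebra.
From mathcomp Require Import boolp zify ring.
Import Order.TTheory GRing.Theory Num.Theory.
Local Open Scope ring_scope.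

Set Implicit Arguments.
Unset Strict Implicit.

(** * Finitely generated modules over a noetherian ring *)

Section Submodules.
Variable k : comNzRingType.
Implicit Types V W : lmodType k.

Definition submodule V (P : V -> Prop) : Prop :=
  P 0 /\ forall a x y, P x -> P y -> P (a *: x + y).

Lemma submoduleZ V (P : V -> Prop) a x : submodule P -> P x -> P (a *: x).
Proof. by move=> [P0 PD] Px; rewrite -[_ *: _]addr0; apply: PD. Qed.

Lemma submoduleD V (P : V -> Prop) x y : submodule P -> P x -> P y -> P (x + y).
Proof. by move=> [P0 PD] Px Py; rewrite -[x]scale1r; apply: PD. Qed.

Lemma submoduleB V (P : V -> Prop) x y : submodule P -> P x -> P y -> P (x - y).
Proof. by move=> [P0 PD] Px Py; rewrite -scaleN1r addrC; apply: PD. Qed.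

Lemma submodule_sum V (P : V -> Prop) (I : Type) (r : seq I) (Q : pred I)
    (F : I -> V) :
  submodule P -> (forall i, Q i -> P (F i)) -> P (\sum_(i <- r | Q i) F i).
Proof.
move=> sP PF; apply: big_ind => //; first by case: sP.
by move=> x y; apply: submoduleD.
Qed.

(** The recursive form lets inductions peel off one generator and its leading coefficient at a
    time. *)
Fixpoint in_span V (s : seq V) (v : V) : Prop :=
  if s is x :: s' then exists c u, in_span s' u /\ v = c *: x + u else v = 0.

Lemma in_span_submodule V (s : seq V) : submodule (in_span s).
Proof.
elim: s => [|x s [IH0 IHD]] /=.
  by split=> // a y z -> ->; rewrite scaler0 addr0.
split; first by exists 0, 0; rewrite scale0r addr0.
move=> a _ _ [c [u [su ->]]] [d [w [sw ->]]].
exists (a * c + d), (a *: u + w); split; first exact: IHD.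
by rewrite scalerDr scalerA scalerDl -!addrA; congr (_ + _); rewrite addrCA.
Qed.

Lemma in_span_mem V (s : seq V) v : v \in s -> in_span s v.
Proof.
elim: s => // x s IH; rewrite inE => /orP[/eqP ->|/IH sv] /=.
  by exists 1, 0; rewrite scale1r addr0; split=> //; case: (in_span_submodule s).
by exists 0, v; rewrite scale0r add0r.
Qed.

Lemma chain_le (T : Type) (P : nat -> T -> Prop) i j v :
  (forall i v, P i v -> P i.+1 v) -> (i <= j)%N -> P i v -> P j v.
Proof.
by move=> Pm /subnK <-; elim: (j - i)%N => //= n IH Pv; apply/Pm/IH.
Qed.

(** The union of the chain is an ideal, and its finitely many generators all lie in one stage. *)
Lemma ideal_chain_stable (P : nat -> k -> Prop) :
  noetherian k -> (forall i, ideal (P i)) ->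
  (forall i v, P i v -> P i.+1 v) ->
  exists r, forall i v, (r <= i)%N -> P i v -> P r v.
Proof.
move=> nk iP Pm.
have [|s sP] := nk (fun x => exists i, P i x).
  split; first by exists 0%N; case: (iP 0%N).
  - move=> x y [i Pix] [j Pjy]; exists (maxn i j).
    have [_ D _] := iP (maxn i j).
    by apply: D; [apply: chain_le _ Pix|apply: chain_le _ Pjy]; rewrite ?leq_maxl ?leq_maxr.
  by move=> a x [i Pix]; exists i; have [_ _] := iP i; apply.
have: exists r, forall i : 'I_(size s), P r s`_i.
  have: forall i : 'I_(size s), exists r, P r s`_i.
    move=> i; apply/sP; exists (fun j => (j == i)%:R).
    rewrite (bigD1 i) //= eqxx mul1r big1 ?addr0 // => j /negPf ->.
    by rewrite mul0r.
  move=> /boolp.choice [f Pf]; exists (\max_i f i) => i.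
  by apply: chain_le _ (Pf i) => //; apply: leq_bigmax.
move=> [r Pr]; exists r => i v _ Piv.
have [c ->] : exists c : 'I_(size s) -> k, v = \sum_(i < size s) c i * s`_i.
  by apply/sP; exists i.
have [P0 PD PM] := iP r.
by apply: big_ind => // j _; apply: PM.
Qed.

(** Induction on the generators: for [x :: s], both the ideals of coefficients of [x] and the
    intersections with the span of [s] become stationary. *)
Lemma submodule_chain_stable V (s : seq V) (P : nat -> V -> Prop) :
  noetherian k -> (forall i, submodule (P i)) ->
  (forall i v, P i v -> P i.+1 v) -> (forall i v, P i v -> in_span s v) ->
  exists r, forall i v, (r <= i)%N -> P i v -> P r v.
Proof.
move=> nk; elim: s P => [|x s IH] P sP Pm Ps.
  by exists 0%N => i v _ /Ps -> ; case: (sP 0%N).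
have [s0 sD] := in_span_submodule s.
have [||r1 h1] := @ideal_chain_stable
    (fun i c => exists u, in_span s u /\ P i (c *: x + u)) nk.
- move=> i; have [P0 PD] := sP i; split.
  + by exists 0; rewrite scale0r addr0.
  + move=> a b [u [su Pu]] [v [sv Pv]]; exists (u + v); split.
      exact: submoduleD (in_span_submodule s) _ _.
    by rewrite scalerDl addrACA; apply: submoduleD.
  + move=> a b [u [su Pu]]; exists (a *: u); split.
      exact: submoduleZ (in_span_submodule s) _.
    by rewrite -scalerA -scalerDr; apply: submoduleZ.
- by move=> i c [u [su /Pm Pu]]; exists u.
have [|||r2 h2] := IH (fun i u => in_span s u /\ P i u).
- move=> i; have [P0 PD] := sP i; split=> // a u v [su Pu] [sv Pv].
  by split; [apply: sD|apply: PD].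
- by move=> i v [sv /Pm].
- by move=> i v [].
exists (maxn r1 r2) => i v; rewrite geq_max => /andP[le1 le2] Pv.
have [c [u [su def_v]]] := Ps _ _ Pv.
(* Subtracting an element of stage [r1] with the same coefficient of [x] leaves an element of the
   span of [s]. *)
have [|u' [su' Pu']] := h1 i c le1; first by exists u; rewrite -def_v.
have Pr : P (maxn r1 r2) (c *: x + u').
  by apply: chain_le _ Pu' => //; apply: leq_maxl.
have -> : v = (c *: x + u') + (u - u').
  by rewrite def_v -addrA [u' + _]addrC subrK.
apply: submoduleD => //.
have [|_] := h2 i (u - u') le2; last first.
  by move=> Pd; apply: chain_le _ Pd => //; apply: leq_maxr.
split; first exact: submoduleB (in_span_submodule s) _ _.
have -> : u - u' = v - (c *: x + u') by rewrite def_v opprD addrACA subrr add0r.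
by apply: submoduleB => //; apply: chain_le _ Pu'.
Qed.

(** The kernels of the iterates are stationary from some [r] on. If [h v = 0] and [v] is the image
    of [u] under the [r]-th iterate, then [u] is killed by iterate [r.+1], hence by iterate [r], so
    [v = 0]. *)
Lemma surj_endo_inj V (s : seq V) (h : {linear V -> V}) :
  noetherian k -> (forall v, in_span s v) ->
  (forall v, exists u, h u = v) -> injective h.
Proof.
move=> nk sV hs.
have itL i : submodule (fun v => iter i h v = 0).
  have E : forall a u v, iter i h (a *: u + v) = a *: iter i h u + iter i h v.
    by elim: i => //= i IH a u v; rewrite IH linearP.
  split; last by move=> a u v; rewrite E => -> ->; rewrite scaler0 addr0.
  by elim: i {E} => //= i ->; rewrite linear0.
have [||r hr] := submodule_chain_stable (s := s) nk itL.
- by move=> i v /= ->; rewrite linear0.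
- by [].
have its i v : exists u, iter i h u = v.
  elim: i v => [|i IH] v; first by exists v.
  have [u <-] := hs v; have [w <-] := IH u.
  by exists w.
apply: raddf_inj => v hv.
have [u def_v] := its r v.
by rewrite -def_v; apply: (hr r.+1) => //=; rewrite def_v.
Qed.

(** Generators modulo [P] are removed one by one: writing [x] in [P + a V] gives [(1 - a * c) *: x]
    in [P] plus the span of [s], and [1 - a * c] is a unit. *)
Lemma nakayama V (s : seq V) (P : V -> Prop) (a : k) :
  (forall c, exists u, u * (1 - a * c) = 1) -> submodule P ->
  (forall v, exists p w, [/\ P p, in_span s w & v = p + w]) ->
  (forall v, exists p w, P p /\ v = p + a *: w) ->
  forall v, P v.
Proof.
move=> ua sP; elim: s => [|x s IH] gen Pa v.
  by have [p [w [Pp -> ->]]] := gen v; rewrite addr0.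
apply: IH => // {v}.
have sS := in_span_submodule s.
have [p1 [w1 [Pp1 sw1 def_x]]] :
    exists p w, [/\ P p, in_span s w & x = p + w].
  have [p [w [Pp def_x]]] := Pa x.
  have [p' [_ [Pp' [c [u [su ->]]] def_w]]] := gen w.
  have [b ub] := ua c.
  exists (b *: (p + a *: p')), ((b * a) *: u); split.
  - by apply: (submoduleZ _ sP); apply: (submoduleD sP) => //; apply: submoduleZ.
  - exact: (submoduleZ _ sS).
  rewrite -scalerA -scalerDr -[LHS]scale1r -ub -scalerA; congr (_ *: _).
  apply/eqP; rewrite scalerBl scale1r subr_eq; apply/eqP.
  by rewrite {1}def_x def_w !scalerDr scalerA -!addrA [a *: u + _]addrC.
move=> v; have [p [_ [Pp [c [u [su ->]]] ->]]] := gen v.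
exists (p + c *: p1), (c *: w1 + u); split.
- by apply: (submoduleD sP) => //; apply: submoduleZ.
- by apply: (submoduleD sS) => //; apply: submoduleZ.
by rewrite {1}def_x scalerDr !addrA.
Qed.

(** Defines maps out of modules known by generators and relations, without forming quotients.
    Single-valuedness reduces to the fibre over 0. *)
Lemma linear_of_graph V W (R : V -> W -> Prop) :
  (forall v, exists w, R v w) ->
  (forall a u v x y, R u x -> R v y -> R (a *: u + v) (a *: x + y)) ->
  (forall x, R 0 x -> x = 0) ->
  exists f : {linear V -> W}, forall v w, R v w -> f v = w.
Proof.
move=> tR lR zR.
have uR v x y : R v x -> R v y -> x = y.
  move=> Rx Ry; apply/eqP; rewrite -subr_eq0; apply/eqP/zR.
  by have := lR (-1) _ _ _ _ Ry Rx; rewrite !scaleN1r addNr [- y + _]addrC.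
have [f Rf] := boolp.choice tR.
have fP : linear f.
  by move=> a u v; apply: (uR (a *: u + v)) => //; apply: lR.
pose F := GRing.isLinear.Build k V W *:%R f fP.
exists (HB.pack_for {linear V -> W} f F) => v w Rvw /=.
exact: uR Rvw.
Qed.

End Submodules.

(** * Maximal ideals and the Jacobson radical *)

Section Jacobson.
Variable k : comNzRingType.
Hypothesis nk : noetherian k.

(** If no such ideal existed, choice would give a strictly increasing chain of proper ideals above
    [I], against noetherianity. *)
Lemma exists_maximal_ideal (I : k -> Prop) :
  ideal I -> ~ I 1 -> exists J, maximal_ideal J /\ forall x, I x -> J x.
Proof.
move=> iI pI; apply: contrapT => nmax.
pose T := {J : k -> Prop | [/\ ideal J, ~ J 1 & forall x, I x -> J x]}.
have step (J : T) : exists J' : T,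
    (forall x, sval J x -> sval J' x) /\ exists x, sval J' x /\ ~ sval J x.
  case: J => J [iJ pJ IJ] /=; apply: contrapT => nJ; apply: nmax.
  exists J; split=> //; split=> // K iK JK.
  have [K1|nK1] := EM (K 1).
    by left=> x; rewrite -[x]mulr1; case: iK => _ _; apply.
  right=> x Kx; apply: contrapT => nJx; apply: nJ.
  have hK : [/\ ideal K, ~ K 1 & forall x, I x -> K x] by split=> // y /IJ/JK.
  by exists (exist _ K hK); split=> //; exists x.
have [f fP] := boolp.choice step.
have hI : [/\ ideal I, ~ I 1 & forall x, I x -> I x] by [].
pose c n : T := iter n f (exist _ I hI).
have [||r rP] := @ideal_chain_stable k (fun n => sval (c n)) nk.
- by move=> i; case: (svalP (c i)).
- by move=> i; have [h _] := fP (c i).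
by have [_ [x [/(rP r.+1) h]]] := fP (c r); apply; apply: h.
Qed.

(** Otherwise a maximal ideal containing [y] would also contain [x], hence 1. *)
Lemma jacobson_comaximal_unit (x y a b : k) :
  in_jacobson x -> a * x + b * y = 1 -> exists u, u * y = 1.
Proof.
move=> Jx ab1; apply: contrapT => ny.
have [||J [mJ yJ]] := @exists_maximal_ideal (fun z : k => exists c : k, z = c * y).
- split; first by exists 0; rewrite mul0r.
  + by move=> _ _ [c ->] [d ->]; exists (c + d); rewrite mulrDl.
  + by move=> e _ [c ->]; exists (e * c); rewrite mulrA.
- by move=> [u u1]; apply: ny; exists u.
have [[_ D M] n1 _] := mJ; apply: n1; rewrite -ab1; apply: D; apply: M.
  exact: Jx.
by apply: yJ; exists 1; rewrite mul1r.
Qed.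

Lemma jacobson_nonunit (x : k) : in_jacobson x -> ~ exists u, u * x = 1.
Proof.
move=> Jx [u u1].
have [||J [mJ _]] := @exists_maximal_ideal (fun z : k => z = 0).
- by split=> [|_ _ -> ->|a _ ->]; rewrite ?addr0 ?mulr0.
- by move=> /= E10; have := oner_neq0 k; rewrite E10 eqxx.
have [[_ _ M] n1 _] := mJ; apply: n1; rewrite -u1.
by apply: M; apply: Jx.
Qed.

End Jacobson.

(** * Divisibility and invertibility of the structure constants *)

Section Coefficients.
Variables (k : comNzRingType) (pi : nat -> k).

Lemma eps_sym j a b : eps j a b = eps j b a.
Proof. by rewrite /eps addnC subnAC. Qed.

Lemma eps_small j a b : (a + b < j)%N -> eps j a b = 0%N.
Proof. by move=> h; rewrite /eps divn_small. Qed.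

(** If [j] divides [p], it divides [a], so the quotients add. If [p] divides [j], dividing first by
    [p] makes [b] disappear. *)
Lemma eps_comparable p j a b : (0 < j)%N -> (p %| a)%N -> (b < p)%N ->
  (j %| p)%N || (p %| j)%N -> eps j a b = 0%N.
Proof.
move=> j0 pa bp /orP[jp|/dvdnP[c def_j]]; rewrite /eps.
  by rewrite divnDl ?(dvdn_trans jp pa) // addKn subnn.
have p0 : (0 < p)%N by apply: leq_ltn_trans bp.
have /dvdnP[x ->] := pa.
by rewrite def_j [(c * p)%N]mulnC !divnMA divnMDl // mulnK // [(b %/ p)%N]divn_small //
  addn0 div0n subnn.
Qed.

(** The residue of [q - u] modulo [p] is [p - u], and adding [u + s < p] crosses exactly one
    multiple of [p]. *)
Lemma eps_carry p q u s : (0 < q)%N -> (p %| q)%N -> (0 < u)%N -> (u + s < p)%N ->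
  eps p (q - u) (u + s) = 1%N.
Proof.
move=> q0 /dvdnP[[|x] def_q] u0 usp; first by rewrite def_q in q0.
have -> : (q - u = x * p + (p - u))%N by rewrite def_q mulSn; lia.
have p0 : (0 < p)%N by lia.
have -> : eps p (x * p + (p - u)) (u + s)
    = ((x.+1 * p + s) %/ p - (x * p + (p - u)) %/ p - (u + s) %/ p)%N.
  by rewrite /eps; congr (_ %/ _ - _ - _)%N; rewrite mulSn; lia.
rewrite !divnMDl // [(s %/ p)%N]divn_small ?[((p - u) %/ p)%N]divn_small
  ?[((u + s) %/ p)%N]divn_small; lia.
Qed.

(** A common range of indices allows coefficients with different [n] to be compared factor by
    factor. *)
Lemma Ccoef_bound N n m : (m <= n < N)%N ->
  Ccoef pi n m = \prod_(2 <= j < N) pi j ^+ eps j (n - m) m.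
Proof.
move=> /andP[mn nN]; rewrite /Ccoef.
have [n1|n1] := leqP 2 n.+1; last first.
  rewrite big_geq; last by lia.
  rewrite big_nat_cond big1 // => j /andP[/andP[j2 _] _].
  by rewrite eps_small ?expr0 ?subnK //; lia.
rewrite [RHS](big_cat_nat n1 nN) /= [X in _ * X]big_nat_cond.
rewrite [X in _ * X]big1 ?mulr1 // => j /andP[/andP[nj _] _].
by rewrite eps_small ?expr0 // subnK.
Qed.

Lemma Ccoef_sym n m : (m <= n)%N -> Ccoef pi n (n - m) = Ccoef pi n m.
Proof.
move=> mn; rewrite /Ccoef; apply: eq_bigr => j _.
by rewrite subKn // eps_sym.
Qed.

(** Both sides are the exponent of the trinomial coefficient for the parts [n - l], [l - m] and
    [m]. *)
Lemma eps_trinomial j n l m : (0 < j)%N -> (m <= l <= n)%N ->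
  (eps j (n - m) m + eps j (n - l) (l - m) = eps j (n - l) l + eps j (l - m) m)%N.
Proof.
move=> j0 /andP[ml ln]; rewrite /eps !subnK ?(leq_trans ml ln) //.
have -> : (n - l + (l - m) = n - m)%N by lia.
have E a b : (a %/ j + b %/ j <= (a + b) %/ j)%N.
  by rewrite divnD //; apply: leq_addr.
have := E (n - m)%N m; have := E (n - l)%N (l - m)%N.
have := E (n - l)%N l; have := E (l - m)%N m.
have -> : (n - l + (l - m) = n - m)%N by lia.
rewrite !subnK ?(leq_trans ml ln) //.
move: (n %/ j)%N (m %/ j)%N (l %/ j)%N ((n - m) %/ j)%N ((n - l) %/ j)%N ((l - m) %/ j)%N.
by clear=> *; lia.
Qed.

Lemma Ccoef_trinomial n l m : (m <= l <= n)%N ->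
  Ccoef pi n m * Ccoef pi (n - m) (l - m) = Ccoef pi n l * Ccoef pi l m.
Proof.
move=> /andP[ml ln]; have mn := leq_trans ml ln.
rewrite !(@Ccoef_bound n.+1); try lia.
rewrite -!big_split /=; apply: eq_big_nat => j /andP[j2 _].
rewrite -!exprD -eps_trinomial ?ml ?ln //; last by lia.
by rewrite subnBA // subnK.
Qed.

Hypotheses (nk : noetherian k) (Hadm : admissible pi).

Lemma jacobson_index_comparable p j : in_jacobson (pi p) -> (0 < p)%N -> (0 < j)%N ->
  (exists u, u * pi j = 1) \/ (p %| j)%N || (j %| p)%N.
Proof.
move=> Sp p0 j0.
have [[a [b ab1]]|nab] := EM (exists a b, a * pi p + b * pi j = 1).
  by left; apply: jacobson_comaximal_unit ab1.
by right; apply: Hadm.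
Qed.

Lemma jacobson_index_dvd p q : in_jacobson (pi p) -> in_jacobson (pi q) ->
  (0 < p <= q)%N -> (p %| q)%N.
Proof.
move=> Sp Sq /andP[p0 pq].
have q0 := leq_trans p0 pq.
have [/(jacobson_nonunit nk Sq)|/orP[]//] := jacobson_index_comparable Sp p0 q0 => //.
by move=> /(dvdn_leq p0) qp; rewrite (_ : q = p) //; apply/eqP; rewrite eqn_leq qp.
Qed.

(** Factors whose index is comparable to [p] have exponent 0; the other [pi j] are comaximal with
    [pi p], hence units. *)
Lemma Ccoef_unit p a b : in_jacobson (pi p) -> (p %| a)%N -> (b < p)%N ->
  exists u, u * Ccoef pi (a + b) b = 1.
Proof.
move=> Sp pa bp; rewrite /Ccoef addnK.
rewrite big_nat_cond; apply: (big_ind (fun x => exists u, u * x = 1)).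
- by exists 1; rewrite mulr1.
- by move=> x y [u ux] [v vy]; exists (u * v); rewrite mulrACA ux vy mulr1.
move=> j /andP[/andP[j2 _] _].
have p0 : (0 < p)%N by apply: leq_ltn_trans bp.
have j0 : (0 < j)%N by apply: ltnW.
have [[u u1]|pj] := jacobson_index_comparable Sp p0 j0.
  by exists (u ^+ eps j a b); rewrite -exprMn u1 expr1n.
by rewrite (eps_comparable (p := p)) // 1?orbC //; exists 1; rewrite mulr1.
Qed.

Lemma Ccoef_carry q u s : (1 < q)%N -> (0 < u)%N -> (u + s < q)%N ->
  exists c, Ccoef pi (q + s) (u + s) = c * pi q.
Proof.
move=> q1 u0 usq; rewrite /Ccoef.
rewrite (bigD1_seq q) /= ?mem_index_iota ?iota_uniq ?q1 ?ltnS ?leq_addr //.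
have -> : (q + s - (u + s) = q - u)%N by lia.
by rewrite eps_carry ?expr1 //; [rewrite mulrC; eexists|lia].
Qed.

(** The cutoff [p] discards the small indices, at which a carry is not guaranteed. *)
Definition jac_prod p q : k :=
  \prod_(2 <= j < q.+1 | (p <= j)%N && `[< in_jacobson (pi j) >]) pi j.

Lemma jac_prod_recr p q : in_jacobson (pi q.+1) -> (0 < q)%N -> (p <= q.+1)%N ->
  jac_prod p q.+1 = jac_prod p q * pi q.+1.
Proof.
move=> Sq q0 pq; rewrite /jac_prod big_mkcond big_nat_recr //= -big_mkcond /=.
by rewrite pq; case: asboolP.
Qed.

Lemma jac_prod_dvd p q : exists c, jac_prod p q.+1 = c * jac_prod p q.
Proof.
rewrite /jac_prod; have [q0|q0] := ltnP 0 q.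
  rewrite big_mkcond big_nat_recr //= -big_mkcond /= mulrC.
  by eexists.
rewrite (_ : q = 0%N); last by lia.
by exists 1; rewrite mul1r !big_geq.
Qed.

(** Each radical index [j] between [p] and [q] divides [q] and exceeds [u + s], so [pi j] occurs
    with exponent exactly 1. *)
Lemma Ccoef_jac_prod p q u s : in_jacobson (pi q) -> (p <= q)%N ->
  (0 < u)%N -> (u + s < p)%N ->
  exists c, Ccoef pi (q + s) (u + s) = c * jac_prod p q.
Proof.
move=> Sq pq u0 usp; have q1 : (2 <= q.+1)%N by lia.
rewrite /Ccoef (@big_cat_nat _ _ _ q.+1) //=; last by lia.
set A := \prod_(2 <= j < _) _; set B := \prod_(_ <= j < _) _.
suff [c ->] : exists c, A = c * jac_prod p q by exists (B * c); rewrite mulrC mulrA.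
have -> : A = \prod_(2 <= j < q.+1)
    ((if (p <= j)%N && `[< in_jacobson (pi j) >] then 1
      else pi j ^+ eps j (q + s - (u + s)) (u + s)) *
     (if (p <= j)%N && `[< in_jacobson (pi j) >] then pi j else 1)).
  apply: eq_big_nat => j /andP[j2 jq].
  case: ifP => [/andP[pj /asboolP Sj]|_]; last by rewrite mulr1.
  have -> : (q + s - (u + s) = q - u)%N by lia.
  rewrite mul1r eps_carry ?expr1 //; try lia.
  by apply: jacobson_index_dvd => //; lia.
by rewrite big_split /= -[X in _ * X]big_mkcond; eexists.
Qed.

End Coefficients.

(** * Evaluation at generators and the action on graded modules *)

Section GradedModules.
Variables (k : comNzRingType) (pi : nat -> k).
Implicit Types M N : gmod pi.

Lemma eval_gensP M r (d : 'I_r -> int) (g : forall t, M (d t)) j a c c' :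
  eval_gens g j (fun t => a * c t + c' t)
  = a *: eval_gens g j c + eval_gens g j c'.
Proof.
rewrite /eval_gens scaler_sumr -big_split /=; apply: eq_bigr => t _.
by rewrite scalerDl scalerA.
Qed.

Lemma eval_gens_linear_gens M r (d : 'I_r -> int) (g h : forall t, M (d t)) j a c :
  eval_gens (fun t => a *: g t + h t) j c = a *: eval_gens g j c + eval_gens h j c.
Proof.
rewrite /eval_gens scaler_sumr -big_split /=; apply: eq_bigr => t _.
by rewrite linearP scalerDr !scalerA mulrC.
Qed.

Lemma eq_eval_gens M r (d : 'I_r -> int) (g : forall t, M (d t)) j c c' :
  (forall t, d t <= j -> c t = c' t) -> eval_gens g j c = eval_gens g j c'.
Proof. by move=> E; apply: eq_bigr => t dt; rewrite E. Qed.

Lemma eval_gens_sum M r (d : 'I_r -> int) (g : forall t, M (d t)) j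
    (I : Type) (s : seq I) (P : pred I) (b : I -> k) (c : I -> 'I_r -> k) :
  eval_gens g j (fun t => \sum_(l <- s | P l) b l * c l t)
  = \sum_(l <- s | P l) b l *: eval_gens g j (c l).
Proof.
rewrite /eval_gens; under eq_bigr do rewrite scaler_suml.
rewrite exchange_big /=; apply: eq_bigr => l _.
by rewrite scaler_sumr; apply: eq_bigr => t _; rewrite scalerA.
Qed.

Lemma gact_eval_gens M r (d : 'I_r -> int) (g : forall t, M (d t)) e j c :
  e <= j -> gact M e j (eval_gens g e c) = eval_gens g j (free_act pi d e j c).
Proof.
move=> ej; rewrite /eval_gens linear_sum /= [LHS]big_mkcond [RHS]big_mkcond /=.
apply: eq_bigr => t _; rewrite /free_act.
have [de|de] := boolP (d t <= e); last by rewrite scale0r; case: ifP.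
by rewrite (le_trans de ej) linearZ /= gact_comp // !scalerA mulrC.
Qed.

Lemma gact_comm M (j j' : int) (q : nat) (v : M j) : j <= j' ->
  gact M (j + q) (j' + q) (gact M j (j + q) v)
  = gact M j' (j' + q) (gact M j j' v).
Proof.
move=> jj; rewrite !gact_comp; try lia.
rewrite -[in LHS]Ccoef_sym; last by lia.
by congr (Ccoef _ _ _ *: _); lia.
Qed.

Definition bounded (lo : int) (B : nat) r (d : 'I_r -> int) : Prop :=
  forall t, lo <= d t <= lo + B.

Hypotheses (nk : noetherian k) (Hadm : admissible pi).

(** The structure constant of the product [x^{[j-i]} x^{[i-d]}] is a unit by [Ccoef_unit]. *)
Lemma gact_factor M (d i j : int) p : in_jacobson (pi p) ->
  d <= i -> i <= j -> (p %| `|j - i|)%N -> (`|(i - d)%R| < p)%N ->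
  exists u, forall v : M d, gact M d j v = u *: gact M i j (gact M d i v).
Proof.
move=> Sp di ij pij idp.
have [u u1] := Ccoef_unit nk Hadm Sp pij idp.
exists u => v; rewrite gact_comp // scalerA.
have -> : `|(j - d)%R|%N = (`|(j - i)%R| + `|(i - d)%R|)%N by lia.
by rewrite u1 scale1r.
Qed.

(** * Projection from degree [j + q] back to degree [j] *)

Section Lift.
Variables (M : gmod pi) (r : nat) (d : 'I_r -> int) (g : forall t, M (d t)).
Variables (lo : int) (B p q : nat).
Hypotheses (Hd : bounded lo B d) (Bp : (B < p)%N) (pq : (p <= q)%N).
Hypotheses (Sq : in_jacobson (pi q)).
Hypothesis Hgen : forall j (v : M j), exists c, in_free d j c /\ v = eval_gens g j c.

(* [M_{j+q}] is spanned by [x^{[q]} M_j] and the multiples of the generators of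
   degree [> j]. [qlift a w y] says that [y] represents the coordinate of [w] along
   the first part, which is well defined modulo [a] when [a] divides
   [jac_prod pi p q]. *)
Definition qlift (a : k) (j : int) (w : M (j + q)) (y : M j) : Prop :=
  exists c z, w = gact M j (j + q) (y + a *: z)
    + \sum_(t | j < d t) c t *: gact M (d t) (j + q) (g t).

Lemma qlift_linear (a : k) (j : int) (b : k) (w w' : M (j + q)) (y y' : M j) :
  qlift a w y -> qlift a w' y' -> qlift a (b *: w + w') (b *: y + y').
Proof.
move=> [c [z ->]] [c' [z' ->]].
exists (fun t => b * c t + c' t), (b *: z + z').
rewrite scalerDr addrACA; congr (_ + _).
  rewrite -linearP; congr (gact _ _ _ _).
  by rewrite !scalerDr !scalerA mulrC addrACA.
rewrite scaler_sumr -big_split; apply: eq_bigr => t _ /=.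
by rewrite scalerDl scalerA.
Qed.

Lemma qlift_gact (a : k) (j : int) (y : M j) : qlift a (gact M j (j + q) y) y.
Proof.
exists (fun => 0), 0; rewrite scaler0 addr0 big1 ?addr0 // => t _.
exact: scale0r.
Qed.

Lemma qlift0 (a : k) (j : int) : qlift a (0 : M (j + q)) 0.
Proof. by rewrite -{1}(linear0 (gact M j (j + q))); apply: qlift_gact. Qed.

Lemma qliftZ (a : k) (j : int) (b : k) (w : M (j + q)) (y : M j) :
  qlift a w y -> qlift a (b *: w) (b *: y).
Proof.
by move=> h; have := qlift_linear b h (qlift0 a j); rewrite !addr0.
Qed.

Lemma qliftD (a : k) (j : int) (w w' : M (j + q)) (y y' : M j) :
  qlift a w y -> qlift a w' y' -> qlift a (w + w') (y + y').
Proof.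
by move=> h h'; have := qlift_linear 1 h h'; rewrite !scale1r.
Qed.

Lemma qlift_sum (a : k) (j : int) (I : Type) (s : seq I) (P : pred I)
    (w : I -> M (j + q)) (y : I -> M j) :
  (forall i, P i -> qlift a (w i) (y i)) ->
  qlift a (\sum_(i <- s | P i) w i) (\sum_(i <- s | P i) y i).
Proof.
move=> h; apply: (big_ind2 (fun w y => qlift a w y)) => //; first exact: qlift0.
by move=> *; apply: qliftD.
Qed.

Lemma qlift_gen (a : k) (j : int) t : j < d t -> qlift a (gact M (d t) (j + q) (g t)) 0.
Proof.
move=> jd; exists (fun t' => (t' == t)%:R), 0.
rewrite scaler0 addr0 linear0 add0r (bigD1 t) //= eqxx scale1r big1 ?addr0 //.
by move=> t' /andP[_ /negPf ->]; rewrite scale0r.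
Qed.

Lemma qlift_mod (a : k) (j : int) (z : M j) : qlift a (gact M j (j + q) (a *: z)) 0.
Proof.
exists (fun => 0), z; rewrite add0r big1 ?addr0 // => t _.
exact: scale0r.
Qed.

Lemma qlift_dvd (a b c : k) (j : int) (w : M (j + q)) (y : M j) :
  b = c * a -> qlift b w y -> qlift a w y.
Proof.
move=> -> [e [z ->]]; exists e, (c *: z).
by rewrite scalerA [a * c]mulrC.
Qed.

Lemma gact_shift (j e : int) : e <= j -> j <= e + B ->
  exists u, forall v : M e, gact M e (j + q) v = u *: gact M j (j + q) (gact M e j v).
Proof.
move=> ej jB; apply: (@gact_factor M e j (j + q) q) => //; try lia.
by rewrite (_ : `|(j + q - j)%R|%N = q) //; lia.
Qed.

Lemma qlift_gen_le (a : k) (j : int) t : lo <= j <= lo + B -> d t <= j ->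
  exists y, qlift a (gact M (d t) (j + q) (g t)) y.
Proof.
move=> jB dj; have /andP[ld dl] := Hd t.
have [||u hu] := @gact_shift j (d t); try lia.
exists (u *: gact M (d t) j (g t)).
by rewrite hu; apply/qliftZ/qlift_gact.
Qed.

Lemma qlift_total (a : k) (j : int) (w : M (j + q)) : lo <= j <= lo + B -> exists y, qlift a w y.
Proof.
move=> jB; have [c [_ ->]] := Hgen w.
rewrite /eval_gens; apply: (big_ind (fun w => exists y, qlift a w y)).
- by exists 0; apply: qlift0.
- by move=> u v [y hy] [z hz]; exists (y + z); apply: qliftD.
move=> t _; suff [y hy] : exists y, qlift a (gact M (d t) (j + q) (g t)) y.
  by exists (c t *: y); apply: qliftZ.
have [dj|jd] := leP (d t) j; first exact: qlift_gen_le.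
by exists 0; apply: qlift_gen.
Qed.

(** A generator of degree in [(j, j']] is no longer among the complementary generators in degree
    [j' + q], but its coefficient there is divisible by [jac_prod pi p q], hence by [a]. *)
Lemma qlift_act (a b : k) (j j' : int) (w : M (j + q)) (y : M j) :
  jac_prod pi p q = b * a -> lo <= j <= j' -> j' <= lo + B ->
  qlift a w y -> qlift a (gact M (j + q) (j' + q) w) (gact M j j' y).
Proof.
move=> def_b /andP[lj jj] jB [c [z ->]].
rewrite linearD /= -[X in qlift _ _ X]addr0; apply: qliftD.
  rewrite gact_comm // [gact M j j' (_ + _)]linearD linearZ linearD.
  rewrite -[X in qlift _ _ X]addr0; apply: qliftD; first exact: qlift_gact.
  exact: qlift_mod.
have -> : 0 = \sum_(t | j < d t) (0 : M j') by rewrite big1.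
rewrite linear_sum /=; apply: qlift_sum => t jd.
rewrite linearZ /= -[0](scaler0 _ (c t)); apply: qliftZ.
have /andP[ld dl] := Hd t.
rewrite gact_comp; try lia.
have [dj'|j'd] := leP (d t) j'; last first.
  by rewrite -[0](scaler0 _ (Ccoef pi `|(j' + q - d t)%R| `|(j + q - d t)%R|));
    apply/qliftZ/qlift_gen.
have [u hu] := @gact_shift j' (d t) dj' ltac:(lia).
(* Symmetry gives the form required by [Ccoef_jac_prod], with [u = d t - j] and [s = j' - d t]. *)
have -> : Ccoef pi `|(j' + q - d t)%R| `|(j + q - d t)%R| =
    Ccoef pi (q + `|(j' - d t)%R|) (`|(d t - j)%R| + `|(j' - d t)%R|).
  by rewrite -Ccoef_sym; [congr (Ccoef _ _ _); lia|lia].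
have [||f ->] := Ccoef_jac_prod nk Hadm (u := `|(d t - j)%R|) (s := `|(j' - d t)%R|) Sq pq; try lia.
rewrite hu def_b scalerA -!mulrA -!scalerA -[0](scaler0 _ f); apply: qliftZ.
rewrite -[0](scaler0 _ b); apply: qliftZ.
by rewrite -[u *: _]linearZ -[a *: _]linearZ; apply: qlift_mod.
Qed.

Variables (s : nat) (e : 'I_s -> int) (rho : 'I_s -> 'I_r -> k).
Hypotheses (He : bounded lo B e).
Hypothesis Hrho : forall l, eval_gens g (e l) (rho l) = 0.
Hypothesis Hrel : forall j c, in_free d j c -> eval_gens g j c = 0 ->
  exists b : 'I_s -> k, forall t,
    c t = \sum_(l < s | e l <= j) b l * free_act pi d (e l) j (rho l) t.

(** A relation in degree [j + q] is a combination of the [rho l]. After division by units, those of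
    degree at most [j] contribute 0 to degree [j], and the others contribute multiples of [a]. *)
Lemma qlift_zero (a b : k) (j : int) (y : M j) :
  jac_prod pi p q = b * a -> lo <= j <= lo + B ->
  qlift a 0 y -> exists z, y = a *: z.
Proof.
move=> def_b jB [c [z0 E]].
pose A (v : M j) := exists z, v = a *: z.
have sA : submodule A.
  split; first by exists 0; rewrite scaler0.
  move=> f _ _ [z ->] [w ->]; exists (f *: z + w).
  by rewrite scalerDr !scalerA mulrC.
suff: A (y + a *: z0).
  by move=> h; rewrite -[y](addrK (a *: z0)); apply: (submoduleB sA) => //; exists z0.
have [c0 [c0free def_y]] := Hgen (y + a *: z0); rewrite def_y in E *.
have /boolp.choice[u hu] : forall t, exists u, d t <= j ->
    u * Ccoef pi `|(j + q - d t)%R| `|(j - d t)%R| = 1.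
  move=> t; have [dj|] := leP (d t) j; last by exists 0.
  have dB := Hd t; have -> : `|(j + q - d t)%R|%N = (q + `|(j - d t)%R|)%N by lia.
  by have [|v ?] := Ccoef_unit nk Hadm Sq (dvdnn q) (b := `|(j - d t)%R|); [lia|exists v].
(* The hypothesis read as a relation in degree [j + q]: generators up to degree [j] come from
   [x^{[q]}], the others from the complement. *)
pose c1 t := if d t <= j then Ccoef pi `|(j + q - d t)%R| `|(j - d t)%R| * c0 t else c t.
have dq t : d t <= j + q by have := Hd t; lia.
have [||f hf] := Hrel (j := j + q) (c := c1).
- by move=> t; rewrite ltNge dq.
- rewrite E gact_eval_gens; last by lia.
  rewrite /eval_gens (bigID (fun t => d t <= j)) /=; congr (_ + _).
    under eq_bigl do rewrite dq.
    rewrite [RHS]big_mkcond [LHS]big_mkcond; apply: eq_bigr => t _.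
    by rewrite dq /c1 /free_act /=; case: (d t <= j); rewrite ?scale0r.
  by apply: eq_big => t; rewrite dq -ltNge // /c1 leNgt /= => ->.
rewrite (_ : eval_gens g j c0 = eval_gens g j (fun t => \sum_(l < s | e l <= j + q)
    f l * (u t * free_act pi d (e l) (j + q) (rho l) t))); last first.
  apply: eq_eval_gens => t dj; under eq_bigr do rewrite mulrCA.
  by rewrite -mulr_sumr -hf /c1 dj mulrA hu // mul1r.
rewrite eval_gens_sum; apply: (submodule_sum _ sA) => l _; apply: (submoduleZ _ sA).
have [ej|je] := leP (e l) j.
  have eB := He l.
  have [|v hv] := Ccoef_unit nk Hadm Sq (dvdnn q) (b := `|(j - e l)%R|); first by lia.
  rewrite (_ : eval_gens _ _ _ = v *: gact M (e l) j (eval_gens g (e l) (rho l))).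
    by rewrite Hrho linear0 scaler0; case: sA.
  rewrite gact_eval_gens // /eval_gens scaler_sumr; apply: eq_bigr => t dj.
  rewrite scalerA; congr (_ *: _); rewrite /free_act.
  have [de|_] := boolP (d t <= e l); last by rewrite !mulr0.
  (* Associativity trades the unit depending on [t] for the unit [v], which depends only on [l] and
     factors out of the sum. *)
  have := Ccoef_trinomial pi (n := `|(j + q - d t)%R|) (l := `|(j - d t)%R|)
    (m := `|(e l - d t)%R|) ltac:(lia).
  have -> : (`|(j + q - d t)%R| - `|(e l - d t)%R| = q + `|(j - e l)%R|)%N by lia.
  have -> : (`|(j - d t)%R| - `|(e l - d t)%R| = `|(j - e l)%R|)%N by lia.
  move=> tri; rewrite !mulrA; congr (_ * _).
  by rewrite -[LHS]mulr1 -hv mulrCA -[u t * _ * _]mulrA tri [u t * _]mulrA hu // mul1r.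
apply: (submodule_sum _ sA) => t dj.
have ld := Hd t; have le := He l.
rewrite /free_act ifT; last by lia.
have -> : Ccoef pi `|(j + q - d t)%R| `|(e l - d t)%R| =
    Ccoef pi (q + `|(j - d t)%R|) (`|(e l - j)%R| + `|(j - d t)%R|).
  by congr (Ccoef _ _ _); lia.
have [||h ->] := Ccoef_jac_prod nk Hadm (u := `|(e l - j)%R|) (s := `|(j - d t)%R|) Sq pq; try lia.
rewrite def_b; exists ((u t * h * b * rho l t) *: gact M (d t) j (g t)).
by rewrite scalerA; congr (_ *: _); ring.
Qed.

End Lift.
End GradedModules.

(** * Comparison of modules that agree in high degrees *)

Section Comparison.
Variables (k : comNzRingType) (pi : nat -> k).
Implicit Types M N : gmod pi.

Lemma giso_of_bijective M N (f : forall j, {linear M j -> N j}) :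
  (forall j j' (v : M j), j <= j' -> f j' (gact M j j' v) = gact N j j' (f j v)) ->
  (forall j, injective (f j)) -> (forall j w, exists v, f j v = w) -> giso M N.
Proof.
move=> fact finj fsurj; exists f; split=> // j.
have [h hK] := boolp.choice (fsurj j).
by exists h => // v; apply: finj; rewrite hK.
Qed.

Lemma trunc_iso_sym n M N : trunc_iso n M N -> trunc_iso n N M.
Proof.
move=> [f [fbij fact]].
have inv j : exists h : {linear N j -> M j}, n <= j -> cancel (f j) h.
  (* Below degree [n] the zero map is a placeholder. *)
  have [nj|_] := boolP (n <= j); last by exists (\0 : {linear N j -> M j}).
  have [|||h hP] := @linear_of_graph k (N j) (M j) (fun w v => f j v = w).
  - by move=> w; have [h _ hK] := fbij j nj; exists (h w).
  - by move=> a u v x y <- <-; rewrite linearP.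
  - by move=> x fx0; apply: (bij_inj (fbij j nj)); rewrite linear0.
  by exists h => _ v; apply: hP.
pose h j := sval (cid (inv j)).
have fK j : n <= j -> cancel (f j) (h j) by rewrite /h; case: cid.
have hK j : n <= j -> cancel (h j) (f j).
  by move=> nj w; have [h0 _ h0K] := fbij j nj; rewrite -[w]h0K fK.
exists h; split=> [j nj|j j' w nj jj'].
  by exists (f j); [apply: hK|apply: fK].
have nj' := le_trans nj jj'.
by rewrite -{1}(hK j nj w) -fact // fK.
Qed.

Lemma trunc_iso_trans n n' M N P :
  trunc_iso n M N -> trunc_iso n' N P -> trunc_iso (Order.max n n') M P.
Proof.
move=> [f [fbij fact]] [f' [fbij' fact']].
exists (fun j => (f' j \o f j)%FUN : {linear M j -> P j}); split=> [j|j j' v].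
  by rewrite ge_max => /andP[nj nj']; apply: bij_comp (fbij' _ nj') (fbij _ nj).
by rewrite ge_max => /andP[nj nj'] jj' /=; rewrite fact // fact'.
Qed.

Lemma common_bound (s : seq int) :
  exists (lo : int) (B : nat), forall x, x \in s -> lo <= x <= lo + B.
Proof.
elim: s => [|x s [lo [B h]]]; first by exists 0, 0%N.
exists (lo - `|x - lo|), (B + `|(x - lo)%R| + `|(x - lo)%R|)%N => y.
by rewrite inE => /orP[/eqP ->|/h]; lia.
Qed.

Lemma eval_gens_in_span M r (d : 'I_r -> int) (g : forall t, M (d t)) j c :
  in_span [seq gact M (d t) j (g t) | t <- enum 'I_r] (eval_gens g j c).
Proof.
apply: (submodule_sum _ (in_span_submodule _)) => t _.
apply: (submoduleZ _ (in_span_submodule _)); apply: in_span_mem.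
by apply: map_f; rewrite mem_enum.
Qed.

Lemma induced_map M N r (d : 'I_r -> int) (g : forall t, M (d t))
    s (e : 'I_s -> int) (rho : 'I_s -> 'I_r -> k) (y : forall t, N (d t)) :
  (forall j (v : M j), exists c, in_free d j c /\ v = eval_gens g j c) ->
  (forall j c, in_free d j c -> eval_gens g j c = 0 ->
    exists b : 'I_s -> k, forall t,
      c t = \sum_(l < s | e l <= j) b l * free_act pi d (e l) j (rho l) t) ->
  (forall l, eval_gens y (e l) (rho l) = 0) ->
  exists f : forall j, {linear M j -> N j},
    forall j c, f j (eval_gens g j c) = eval_gens y j c.
Proof.
move=> Hgen Hrel Hy.
have ex j : exists f : {linear M j -> N j},
    forall c, f (eval_gens g j c) = eval_gens y j c.
  have [|||f fP] := @linear_of_graph k (M j) (N j)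
    (fun v w => exists c, v = eval_gens g j c /\ w = eval_gens y j c).
  - by move=> v; have [c [_ ->]] := Hgen j v; exists (eval_gens y j c), c.
  - move=> a u v x z [c [-> ->]] [c' [-> ->]].
    by exists (fun t => a * c t + c' t); rewrite !eval_gensP.
  - move=> x [c [gc0 ->]].
    have [b hb] : exists b : 'I_s -> k, forall t, d t <= j ->
        c t = \sum_(l < s | e l <= j) b l * free_act pi d (e l) j (rho l) t.
      (* [Hrel] requires [in_free]; the entries set to 0 are ignored by [eval_gens]. *)
      pose c' t := if d t <= j then c t else 0.
      have [||b hb] := Hrel j c'.
      + by move=> t; rewrite /c' ltNge => /negPf ->.
      + by rewrite gc0; apply: eq_eval_gens => t; rewrite /c' => ->.
      by exists b => t dj; rewrite -hb /c' dj.
    rewrite (eq_eval_gens y hb) eval_gens_sum big1 // => l ej.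
    by rewrite -gact_eval_gens // Hy linear0 scaler0.
  by exists f => c; apply: fP; exists c.
exists (fun j => sval (cid (ex j))) => j c.
by case: cid.
Qed.

(* Principal form of Artin-Rees: with [a_i := jac_prod pi p i], the chain of
   submodules [(im G : a_i)], [G] being evaluation of the relations at tuples of
   elements of [N], is stationary, so that
   [a_q Q \cap im G = pi_q a_(q-1) (im G : a_(q-1))] lies in [pi_q im G]. *)
Lemma relation_correction N r' (d' : 'I_r' -> int) (g' : forall t, N (d' t))
    r (d : 'I_r -> int) s (e : 'I_s -> int) (rho : 'I_s -> 'I_r -> k) p :
  noetherian k ->
  (forall j (v : N j), exists c, in_free d' j c /\ v = eval_gens g' j c) ->
  exists i0, forall q, (i0 < q)%N -> (p <= q)%N -> in_jacobson (pi q) ->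
    forall y : forall t, N (d t),
      (forall l, exists v, eval_gens y (e l) (rho l) = jac_prod pi p q *: v) ->
      exists z : forall t, N (d t), forall l,
        eval_gens (fun t => pi q *: z t + y t) (e l) (rho l) = 0.
Proof.
move=> nk Hgen'.
(* The colon modules are pulled back to coefficient matrices, so that the chain lies in one finitely
   generated module. *)
pose P i (C : 'M[k]_(s, r')) := exists z : forall t, N (d t), forall l,
  eval_gens z (e l) (rho l) = jac_prod pi p i *: eval_gens g' (e l) (C l).
pose S := [seq delta_mx ij.1 ij.2 : 'M[k]_(s, r') | ij <- enum {: 'I_s * 'I_r'}].
have Pm i C : P i C -> P i.+1 C.
  move=> [z hz]; have [c hc] := jac_prod_dvd pi p i.
  exists (fun t => c *: z t + 0) => l.
  rewrite eval_gens_linear_gens hz hc scalerA [X in _ + X]big1 ?addr0 // => t _.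
  by rewrite linear0 scaler0.
have [|//||i0 hi0] := submodule_chain_stable (s := S) (P := P) nk.
- move=> i; split.
    exists (fun => 0) => l; rewrite /eval_gens !big1 ?scaler0 // => t _.
      by rewrite mxE scale0r.
    by rewrite linear0 scaler0.
  move=> a C C' [z hz] [z' hz']; exists (fun t => a *: z t + z' t) => l.
  have -> : eval_gens g' (e l) ((a *: C + C') l) =
      a *: eval_gens g' (e l) (C l) + eval_gens g' (e l) (C' l).
    by rewrite -eval_gensP; apply: eq_eval_gens => t _; rewrite !mxE.
  by rewrite eval_gens_linear_gens hz hz' scalerDr !scalerA mulrC.
- move=> i C _; rewrite [C]matrix_sum_delta.
  have sS := in_span_submodule S.
  apply: (submodule_sum _ sS) => i1 _; apply: (submodule_sum _ sS) => j1 _.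
  apply: (submoduleZ _ sS); apply: in_span_mem.
  by apply/mapP; exists (i1, j1) => //; rewrite mem_enum.
exists i0.+1 => -[//|q] iq pq Sq y Hy.
have [C hC] : exists C : 'M[k]_(s, r'), forall l,
    eval_gens y (e l) (rho l) = jac_prod pi p q.+1 *: eval_gens g' (e l) (C l).
  have /boolp.choice[c hc] : forall l, exists c : 'I_r' -> k,
      eval_gens y (e l) (rho l) = jac_prod pi p q.+1 *: eval_gens g' (e l) c.
    move=> l; have [v ->] := Hy l; have [c [_ ->]] := Hgen' _ v.
    by exists c.
  exists (\matrix_(l, t) c l t) => l; rewrite hc; congr (_ *: _).
  by apply: eq_eval_gens => t _; rewrite mxE.
(* The tuple [y] puts [C] in stage [q.+1]; stationarity brings it down to stage [i0], hence into
   stage [q]. *)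
have [z hz] : P q C.
  have le_q : (i0 <= q)%N by exact: ltnW iq.
  by apply: (chain_le Pm le_q); apply: hi0 (leqW le_q) _; exists y.
exists (fun t => - z t) => l.
have -> : (fun t => pi q.+1 *: - z t + y t) = (fun t => - pi q.+1 *: z t + y t).
  by apply: functional_extensionality_dep => t; rewrite scalerN scaleNr.
rewrite eval_gens_linear_gens hC hz jac_prod_recr //; last by lia.
by rewrite scalerA mulNr scaleNr mulrC addNr.
Qed.

Hypotheses (nk : noetherian k) (Hadm : admissible pi).

(** * Transport of coordinates along an isomorphism in high degrees *)

Section Transfer.
Variables (M N : gmod pi) (n : int) (f : forall j, {linear M j -> N j}).
Hypothesis Hf : forall (j j' : int) (v : M j), n <= j -> j <= j' ->
  f j' (gact M j j' v) = gact N j j' (f j v).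
Variables (r : nat) (d : 'I_r -> int) (g : forall t, M (d t)).
Variables (r' : nat) (d' : 'I_r' -> int) (g' : forall t, N (d' t)).
Variables (lo : int) (B p q : nat).
Hypotheses (Hd : bounded lo B d) (Hd' : bounded lo B d') (Hn : n <= lo + B).
Hypotheses (Bp : (B < p)%N) (pq : (p < q)%N).
Hypotheses (Sp : in_jacobson (pi p)) (Sq : in_jacobson (pi q)).
Hypothesis Hgen' : forall j (v : N j), exists c, in_free d' j c /\ v = eval_gens g' j c.

(** Since [d t + q] is at least [n], [f] commutes with the action after [x^{[q]}] is applied, and
    [qlift_act] carries the coordinates along. *)
Lemma qlift_transfer (a b : k) (y : forall t, N (d t)) :
  jac_prod pi p q = b * a ->
  (forall t, qlift g' (q := q) a (f (d t + q) (gact M (d t) (d t + q) (g t))) (y t)) ->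
  forall (j : int) c, lo <= j <= lo + B ->
  qlift g' (q := q) a (f (j + q) (gact M j (j + q) (eval_gens g j c))) (eval_gens y j c).
Proof.
move=> def_b hy j c jB; rewrite /eval_gens !linear_sum /=.
apply: qlift_sum => t dj; rewrite !linearZ; apply: qliftZ.
have ld := Hd t.
rewrite -gact_comm // Hf; try lia.
by apply: (qlift_act nk Hadm Hd' Bp (ltnW pq) Sq def_b) (hy t); lia.
Qed.

(* [f] commutes with the action only in degrees [>= n], so one factors through the
   multiples of the generators in degree [j + p]; there [x^{[q - p]}] sends the degree
   [j + p] part of [N] to elements with zero coordinate modulo [pi q]. *)
Lemma qlift_tail (j : int) t : lo <= j <= lo + B -> j < d t ->
  qlift g' (q := q) (pi q) (f (j + q) (gact M (d t) (j + q) (g t))) 0.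
Proof.
move=> jB jd; have ld := Hd t.
have pdq : (p %| q)%N by apply: (jacobson_index_dvd nk Hadm Sp Sq); lia.
have [||||u hu] := @gact_factor k pi nk Hadm M (d t) (j + p) (j + q) p Sp; try lia.
  by rewrite (_ : `|(j + q - (j + p))%R|%N = (q - p)%N) ?dvdn_sub //; lia.
rewrite hu linearZ -[0](scaler0 _ u); apply: qliftZ.
rewrite Hf; try lia.
have [c [_ ->]] := Hgen' (f (j + p) (gact M (d t) (j + p) (g t))).
rewrite /eval_gens linear_sum.
have -> : 0 = \sum_(t < r' | d' t <= j + p) (0 : N j) by rewrite big1.
apply: qlift_sum => t' _; rewrite linearZ -[0](scaler0 _ (c t')); apply: qliftZ.
have ld' := Hd' t'.
rewrite gact_comp; try lia.
have [dj|jd'] := leP (d' t') j; last first.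
  by rewrite -[0](scaler0 _ (Ccoef pi `|(j + q - d' t')%R| `|(j + p - d' t')%R|));
    apply/qliftZ/qlift_gen.
(* Since [p] properly divides [q], there is room for the carry: [p + (j - d' t') < p + p <= q]. *)
have pq2 : (p + p <= q)%N.
  case/dvdnP: pdq pq => -[|[|x]] ->; rewrite ?mulSn; lia.
have -> : Ccoef pi `|(j + q - d' t')%R| `|(j + p - d' t')%R| =
    Ccoef pi (q + `|(j - d' t')%R|) (p + `|(j - d' t')%R|).
  by congr (Ccoef _ _ _); lia.
have [|||h ->] := @Ccoef_carry k pi q p `|(j - d' t')%R|; try lia.
have [||v hv] := @gact_shift k pi nk Hadm N B p q Bp (ltnW pq) Sq j (d' t'); try lia.
rewrite hv -scalerA -[0](scaler0 _ h); apply: qliftZ.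
by rewrite -[v *: _]linearZ -[pi q *: _]linearZ; apply: qlift_mod.
Qed.

End Transfer.
Lemma exists_surjection M N n :
  (forall m : nat, exists q : nat, (m <= q)%N /\ in_jacobson (pi q)) ->
  fin_pres M -> fin_pres N -> trunc_iso n M N ->
  exists phi : forall j, {linear M j -> N j},
    (forall j j' (v : M j), j <= j' -> phi j' (gact M j j' v) = gact N j j' (phi j v)) /\
    (forall j w, exists v, phi j v = w).
Proof.
move=> Hjac [r [d [g [Hgen [s [e [rho [Hrho Hrel]]]]]]]].
move=> [r' [d' [g' [Hgen' [s' [e' [rho' [Hrho' Hrel']]]]]]]] [f [fbij fact]].
have [lo [B hB]] := common_bound (n :: codom d ++ codom e ++ codom d' ++ codom e').
have Hn : n <= lo + B by have := hB n (mem_head _ _); lia.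
have Hd : bounded lo B d by move=> t; apply: hB; rewrite inE !mem_cat codom_f orbT.
have He : bounded lo B e by move=> t; apply: hB; rewrite inE !mem_cat codom_f !orbT.
have Hd' : bounded lo B d' by move=> t; apply: hB; rewrite inE !mem_cat codom_f !orbT.
have He' : bounded lo B e' by move=> t; apply: hB; rewrite inE !mem_cat codom_f !orbT.
(* [p] exceeds the width of the window of degrees; [q] exceeds [p] and the stationarity index. *)
have [p [Bp Sp]] := Hjac B.+1.
have [i0 hi0] := relation_correction d e rho p nk Hgen'.
have [q [iq Sq]] := Hjac (maxn i0 p).+1.
have pq : (p < q)%N by apply: leq_trans iq; rewrite ltnS leq_maxr.
have i0q : (i0 < q)%N by apply: leq_trans iq; rewrite ltnS leq_maxl.
set a := jac_prod pi p q.
have def_a : a = 1 * a by rewrite mul1r.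
have def_a' : a = jac_prod pi p q.-1 * pi q.
  have [q1 Eq] : exists q1, q = q1.+1 by exists q.-1; lia.
  by rewrite /a; move: Sq; rewrite Eq => Sq1; rewrite jac_prod_recr //; lia.
have /fin_all_exists[y hy] : forall t, exists y : N (d t),
    qlift g' (q := q) a (f (d t + q) (gact M (d t) (d t + q) (g t))) y.
  by move=> t; apply: (qlift_total nk Hadm Hd' Bp (ltnW pq) Sq Hgen').
have K := qlift_transfer fact Hd Hd' Hn Bp pq Sq def_a hy.
(* The relations of [M] hold for [y] modulo [a], because their values at [y] are coordinates of
   0. *)
have [|z hz] := hi0 q i0q (ltnW pq) Sq y.
  move=> l.
  apply: (qlift_zero nk Hadm Hd' Bp (ltnW pq) Sq Hgen' He' _ Hrel' def_a (He l)).
    by move=> l'; case: (Hrho' l').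
  have := K (e l) (rho l) (He l).
  by rewrite (Hrho l).2 !linear0.
have [phi hphi] := induced_map Hgen Hrel hz.
have phi_gact j j' (v : M j) : j <= j' -> phi j' (gact M j j' v) = gact N j j' (phi j v).
  move=> jj'; have [c [_ ->]] := Hgen j v.
  by rewrite gact_eval_gens // !hphi gact_eval_gens.
exists phi; split=> //.
(* Pull [x^{[q]} g' t] back to [M] and split it there. Its image has coordinate [eval_gens y j c1]
   modulo [pi q], but also [g' t], so the two agree modulo [pi q]. *)
have phi_gen t : exists v w, g' t = phi (d' t) v + pi q *: w.
  set j := d' t; have jB : lo <= j <= lo + B by apply: Hd'.
  have nj : n <= j + q by lia.
  have [h _ hK] := fbij _ nj.
  have [y0 [c [z0 E]]] := qlift_total nk Hadm Hd Bp (ltnW pq) Sq Hgen a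
    (h (gact N j (j + q) (g' t))) jB.
  have [c1 [_ def_y0]] := Hgen j (y0 + a *: z0); rewrite def_y0 in E.
  have L1 : qlift g' (q := q) (pi q) (gact N j (j + q) (g' t)) (eval_gens y j c1).
    rewrite -[gact N _ _ _]hK E linearD -[X in qlift _ _ _ X]addr0; apply: qliftD.
      exact: qlift_dvd def_a' (K j c1 jB).
    rewrite linear_sum; have -> : 0 = \sum_(t < r | j < d t) (0 : N j) by rewrite big1.
    apply: qlift_sum => t' jt; rewrite linearZ -[0](scaler0 _ (c t')); apply: qliftZ.
    exact: (qlift_tail fact g Hd Hd' Hn Bp pq Sp Sq Hgen' jB jt).
  have [] := qlift_zero nk Hadm Hd' Bp (ltnW pq) Sq Hgen' He' (fun l => (Hrho' l).2) Hrel'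
    (y := - 1 *: eval_gens y j c1 + g' t) def_a' jB.
    have -> : 0 = - 1 *: gact N j (j + q) (g' t) + gact N j (j + q) (g' t).
      by rewrite scaleN1r addNr.
    exact: qlift_linear L1 (qlift_gact g' q (pi q) (g' t)).
  (* [phi] uses the corrected tuple [pi q *: z t + y t]; the correction is absorbed into the
     multiple of [pi q]. *)
  move=> w hw; exists (eval_gens g j c1), (w - eval_gens z j c1).
  rewrite hphi eval_gens_linear_gens scalerBr -hw scaleN1r.
  by rewrite addrC addrA subrK addrC addNKr.
have phi_mod j w : exists v u, w = phi j v + pi q *: u.
  have [c [_ ->]] := Hgen' j w; rewrite /eval_gens.
  apply: (big_ind (fun w => exists v u, w = phi j v + pi q *: u)).
  - by exists 0, 0; rewrite linear0 scaler0 addr0.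
  - move=> _ _ [v [u ->]] [v' [u' ->]]; exists (v + v'), (u + u').
    by rewrite linearD scalerDr addrACA.
  move=> t dj; have [v [u ->]] := phi_gen t.
  exists (c t *: gact M (d' t) j v), (c t *: gact N (d' t) j u).
  by rewrite [phi j _]linearZ phi_gact // linearD [gact N _ _ (pi q *: u)]linearZ
    scalerDr !scalerA mulrC.
move=> j; apply: (nakayama (s := [seq gact N (d' t) j (g' t) | t <- enum 'I_r']) (a := pi q)).
- move=> c; apply: (jacobson_comaximal_unit nk (a := c) (b := 1) Sq).
  by rewrite mul1r mulrC addrC subrK.
- split; first by exists 0; rewrite linear0.
  by move=> c _ _ [u <-] [v <-]; exists (c *: u + v); rewrite linearP.
- move=> w; have [c [_ ->]] := Hgen' j w.
  exists 0, (eval_gens g' j c); split; [|exact: eval_gens_in_span|by rewrite add0r].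
  by exists 0; rewrite linear0.
- move=> w; have [v [u ->]] := phi_mod j w.
  by exists (phi j v), u; split=> //; exists v.
Qed.

End Comparison.

Theorem theorem9p12 (k : comNzRingType) (pi : nat -> k)
  (Hnoeth : noetherian k)
  (Hpi : pi_sequence pi) (Hadm : admissible pi)
  (Hjac : forall N : nat, exists n : nat, (N <= n)%N /\ in_jacobson (pi n)) :
  (forall M N : gmod pi, fin_pres M -> fin_pres N ->
     (exists n : int, trunc_iso n M N) -> giso M N) /\
  (forall M N1 N2 : gmod pi, nearly_fp M ->
     weak_fp_envelope N1 M -> weak_fp_envelope N2 M -> giso N1 N2).
Proof.
have main (M N : gmod pi) n : fin_pres M -> fin_pres N -> trunc_iso n M N -> giso M N.
  move=> fM fN tMN.
  have [phi [phi_act phi_surj]] := exists_surjection Hnoeth Hadm Hjac fM fN tMN.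
  have [psi [_ psi_surj]] :=
    exists_surjection Hnoeth Hadm Hjac fN fM (trunc_iso_sym tMN).
  apply: (giso_of_bijective phi_act) => // j.
  have [r [d [g [Hgen _]]]] := fM.
  pose h : {linear M j -> M j} := (psi j \o phi j)%FUN.
  have h_inj : injective h.
    apply: (surj_endo_inj (s := [seq gact M (d t) j (g t) | t <- enum 'I_r]) Hnoeth).
      by move=> v; have [c [_ ->]] := Hgen j v; apply: eval_gens_in_span.
    move=> v; have [w <-] := psi_surj j v; have [u <-] := phi_surj j w.
    by exists u.
  by move=> u v /(congr1 (psi j)); apply: h_inj.
split=> [M N fM fN [n]|M N1 N2 _ [f1 [n1 t1]] [f2 [n2 t2]]]; first exact: main.
exact: main (trunc_iso_trans (trunc_iso_sym t1) t2).
Qed.
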